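(* Let $X$ be a completely regular topological space and let $x_0\in X$. Then the whisker topology on $\widetilde X$ is identical with the topology induced on $\widetilde X$ by the Berestovskii-Plaut uniform structure corresponding to the canonical uniform structure $CU(X)$ on $X$.
   Context: $\widetilde X$ is the set of homotopy classes $[\alpha]$ (rel. end-points) of paths $\alpha\colon[0,1]\to X$ with $\alpha(0)=x_0$. The whisker topology on $\widetilde X$ has basis $B([\alpha],U)=\{[\alpha\ast\beta]\}$, where $\alpha$ is a path in $X$ from $x_0$ to $x_1$, $U$ is a neighborhood of $x_1$ in $X$, and $\beta$ ranges over paths in $U$ originating at $x_1$. Entourages of uniform structures are taken to be symmetric. For an entourage $E$ of a uniform space $X$, $B(x,E)=\{y : (x,y)\in E\}$; a subset (or a path, via its image) is $E$-bounded if it is contained in $B(x,E)$ for some $x\in X$. The topology induced by a uniform structure: $U$ is open iff for each $x\in U$ there is an entourage $E_x$ with $B(x,E_x)\subset U$. The Berestovskii-Plaut uniform structure on $\widetilde X$ for a uniform space $X$ has as base the sets $bp(E)$, $E$ an entourage of $X$, where $bp(E)$ consists of pairs $([\alpha],[\beta])$ such that $\alpha^{-1}\ast\beta$ is homotopic in $X$ rel. end-points to an $E$-bounded path. The canonical uniform structure $CU(X)$ on a topological space $X$: a symmetric set $E\subset X\times X$ is an entourage iff there is a partition of unity $f=\{f_s\}_{s\in S}$ on $X$ (a family of continuous functions $f_s\colon X\to[0,1]$ with $\sum_{s\in S}f_s(x)=1$ for all $x\in X$) such that $E$ contains $E_f:=\{(x,y)\in X\times X : \text{there is } s\in S\text{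 with } f_s(x)\cdot f_s(y)>0\}$. *)

(* Defs.v *)
From HB Require Import structures.
From mathcomp Require Import all_boot all_order all_algebra.
From mathcomp Require Import all_classical all_reals all_analysis.
Import Order.TTheory GRing.Theory Num.Theory.
Import numFieldNormedType.Exports.

Set Implicit Arguments.
Unset Strict Implicit.
Unset Printing Implicit Defensive.

Local Open Scope classical_set_scope.
Local Open Scope ring_scope.

(* A path [0,1] -> X is represented by a function R -> X whose restriction to
   `[0, 1] is continuous; the values outside `[0, 1] are irrelevant: they never
   enter [path_homotopic] or [path_image]. *)
Section Paths.
Context {R : realType} {X : topologicalType}.
Implicit Types (a b g : R -> X) (x : X).

Definition is_path a : Prop := {within `[0, 1], continuous a}.

Definition path_from x a : Prop := is_path a /\ a 0 = x.

Definition path_image a : set X := a @` `[0, 1].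

Definition path_inv a : R -> X := fun t => a (1 - t).

Definition path_cat a b : R -> X :=
  fun t => if t <= 2^-1 then a (t *+ 2) else b (t *+ 2 - 1).

(* Homotopy relative to the end points; the second variable of H is the
   deformation parameter. *)
Definition path_homotopic a b : Prop :=
  exists H : R * R -> X,
    [/\ {within `[0, 1] `*` `[0, 1], continuous H},
        (forall t : R, t \in `[0, 1] -> H (t, 0) = a t /\ H (t, 1) = b t) &
        (forall s : R, s \in `[0, 1] -> H (0, s) = a 0 /\ H (1, s) = a 1)].

Definition path_class a : set (R -> X) := [set b | path_homotopic a b].

End Paths.

(* The set of homotopy classes of paths issuing from x0; an element of it is
   [alpha] when its underlying set of paths is [path_class alpha]. *)
Definition path_classes_from (R : realType) (X : topologicalType) (x0 : X)
    : set (set (R -> X)) :=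
  [set path_class a | a in path_from x0].

Definition Xtilde (R : realType) (X : topologicalType) (x0 : X) : Type :=
  set_type (@path_classes_from R X x0).

Definition topology_of_base {T : Type} (base : set_system T) : set_system T :=
  [set \bigcup_(B in F) B | F in [set F | F `<=` base]].

Section Whisker.
Context (R : realType) {X : topologicalType} (x0 : X).

Definition whisker_nbhd (a : R -> X) (U : set X) : set (Xtilde R x0) :=
  [set d | exists b : R -> X,
     [/\ path_from (a 1) b, path_image b `<=` U &
         set_val d = path_class (path_cat a b)]].

(* The neighborhoods are open ones: for arbitrary neighborhoods U the sets
   B([alpha], U) would already generate the discrete topology when X = R. *)
Definition whisker_base : set_system (Xtilde R x0) :=
  [set B | exists (a : R -> X) (U : set X),
     [/\ path_from x0 a, open_nbhs (a 1) U & B = whisker_nbhd a U]].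

Definition whisker_topology : set_system (Xtilde R x0) :=
  topology_of_base whisker_base.

End Whisker.

Arguments whisker_topology R {X} x0.

(* A uniform structure is handled through its family of symmetric entourages. *)
Section Uniform.
Context {T : Type}.

Definition symmetric_set (E : set (T * T)) : Prop := (E^-1)%relation = E.

Definition uniformity_of_base (base : set_system (T * T))
    : set_system (T * T) :=
  [set E | symmetric_set E /\ exists2 B, base B & B `<=` E].

(* [nbhs_ ent x U] says that U contains B(x, E) for some E in ent. *)
Definition uniform_topology (ent : set_system (T * T)) : set_system T :=
  [set U | forall x, U x -> nbhs_ ent x U].

End Uniform.

Section BerestovskiiPlaut.
Context (R : realType) {X : topologicalType} (x0 : X).

Definition bounded_path (E : set (X * X)) (g : R -> X) : Prop :=
  is_path g /\ exists x, path_image g `<=` xsection E x.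

Definition bp (E : set (X * X)) : set (Xtilde R x0 * Xtilde R x0) :=
  [set p | exists a b g : R -> X,
     [/\ path_from x0 a /\ set_val p.1 = path_class a,
         path_from x0 b /\ set_val p.2 = path_class b,
         bounded_path E g &
         path_homotopic (path_cat (path_inv a) b) g]].

Definition bp_uniformity (ent : set_system (X * X))
    : set_system (Xtilde R x0 * Xtilde R x0) :=
  uniformity_of_base [set bp E | E in ent].

End BerestovskiiPlaut.

Arguments bp_uniformity R {X} x0 ent.

Section CanonicalUniformity.
Context (R : realType) (X : topologicalType).

Definition partition_of_unity (S : choiceType) (f : S -> X -> R) : Prop :=
  [/\ (forall s, continuous (f s)),
      (forall s x, 0 <= f s x <= 1) &
      (forall x, \esum_(s in [set: S]) (f s x)%:E = 1%E)].

Definition partition_relation (S : choiceType) (f : S -> X -> R)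
    : set (X * X) :=
  [set p | exists s, 0 < f s p.1 * f s p.2].

Definition canonical_uniformity : set_system (X * X) :=
  [set E | symmetric_set E /\
     exists (S : choiceType) (f : S -> X -> R),
       partition_of_unity f /\ partition_relation f `<=` E].

End CanonicalUniformity.

Arguments canonical_uniformity R X : clear implicits.

(* Main.v *)
Require Import Defs.
From mathcomp Require Import all_boot all_order all_algebra.
From mathcomp Require Import all_classical all_reals all_analysis.
From mathcomp Require Import ring lra.
Import Order.TTheory GRing.Theory Num.Theory.
Import numFieldNormedType.Exports.

(** Both topologies compare classes [alpha] and [beta] by the class of the path
    alpha^-1 * beta: the first asks that beta be alpha followed by a path in a
    small neighborhood of alpha(1), the second that alpha^-1 * beta be
    homotopic to a small path. The two conditions are exchanged by the groupoid
    laws of path classes, notably a^-1 * (a * b) ~ b ([path_cat_invK]) and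
    associativity ([path_catA]).

    What remains is a comparison of the two notions of smallness, and it only
    concerns X and the entourages, so each inclusion is proved for any family
    of entourages related in the right way to the open sets of X.

    - [bp_open_whisker_open]: when B(x, E) contains an open neighborhood V of x
      for each entourage E, then B([alpha], V) lies in the bp(E)-ball about
      [alpha], since a path in V issuing from x = alpha(1) is E-bounded. For
      CU(X), V = {f_s > 0} works, where f_s(x) > 0
      ([canonical_entourage_nbhs]); this holds in any space.

    - [whisker_open_bp_open]: an E-bounded path issuing from y lies in a ball
      B(x, E) that contains y, but whose center x is arbitrary. So each open
      neighborhood U of y must contain all the balls B(x, E) through y, for some
      entourage E. For CU(X) this uses complete regularity: take h : X -> [0, 1]
      with h(y) = 0 and h = 1 off U, and pull back by h the partition of unity
      on [0, 1] made of the hat functions at the nodes 0, 1/2 and 1. Two points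
      related to a common x cannot be sent to 0 and 1
      ([hat_partition_separates]).

    The groupoid laws are instances of one fact: if two changes of parameters
    agree at 0 and 1, then they turn a given path into homotopic paths, because
    [0, 1] is convex ([reparam_homotopic]). *)

Set Implicit Arguments.
Unset Strict Implicit.
Unset Printing Implicit Defensive.

Local Open Scope classical_set_scope.
Local Open Scope ring_scope.

(** * Continuity *)

Lemma within_comp (Z Y X : topologicalType) (A : set Z) (B : set Y)
    (f : Y -> X) (u : Z -> Y) :
  continuous u -> (forall z, A z -> B (u z)) ->
  {within B, continuous f} -> {within A, continuous (f \o u)}.
Proof.
move=> cu uAB /subspace_continuousP cf; apply/subspace_continuousP => z Az V Vz.
have := cf _ (uAB z Az) V Vz; rewrite /= !nbhs_simpl /= => /cu.
by rewrite /nbhs /= /within /=; apply: filterS => w Vw Aw; exact/Vw/uAB.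
Qed.

(** The pasting lemma along a level set of [u], in the shape in which
    concatenations of paths and of homotopies are defined. *)
Lemma within_glue (R : realType) (Z X : topologicalType) (D : set Z)
    (u : Z -> R) (c : R) (f g : Z -> X) :
  closed D -> continuous u ->
  {within D `&` [set z | u z <= c], continuous f} ->
  {within D `&` [set z | c <= u z], continuous g} ->
  (forall z, D z -> u z = c -> f z = g z) ->
  {within D, continuous (fun z => if u z <= c then f z else g z)}.
Proof.
move=> clD cu cf cg fg.
have -> : D = (D `&` [set z | u z <= c]) `|` (D `&` [set z | c <= u z]).
  rewrite -setIUr; apply/seteqP; split => z; last by case.
  by move=> Dz; split=> //=; case: (leP (u z) c) => [|/ltW]; [left|right].
apply: withinU_continuous.
- apply: closedI => //.
  by move/continuous_closedP : cu => /(_ _ (@closed_le _ c)).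
- apply: closedI => //.
  by move/continuous_closedP : cu => /(_ _ (@closed_ge _ c)).
- apply: subspace_eq_continuous cf => z /set_mem[_ /= uz].
  by rewrite /from_subspace uz.
- apply: subspace_eq_continuous cg => z /set_mem[Dz /= cz].
  rewrite /from_subspace; case: ifPn => // zc.
  by apply/esym/fg => //; apply/le_anti; rewrite zc.
Qed.

Section ContinuousOps.
Context {R : realType} {Z : topologicalType}.
Implicit Types f g : Z -> R.

Lemma continuous_add f g :
  continuous f -> continuous g -> continuous (fun z => f z + g z).
Proof. by move=> cf cg z; apply: cvgD; [exact: cf|exact: cg]. Qed.

Lemma continuous_mul f g :
  continuous f -> continuous g -> continuous (fun z => f z * g z).
Proof. by move=> cf cg z; apply: cvgM; [exact: cf|exact: cg]. Qed.

Lemma continuous_opp f : continuous f -> continuous (fun z => - f z).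
Proof. by move=> cf z; apply: cvgN; exact: cf. Qed.

Lemma continuous_natmul f n : continuous f -> continuous (fun z => f z *+ n).
Proof. by move=> cf z; apply: cvgMn; exact: cf. Qed.

Lemma continuous_abs f : continuous f -> continuous (fun z => `|f z|).
Proof. by move=> cf z; apply: cvg_norm; exact: cf. Qed.

Lemma continuous_maxr f g :
  continuous f -> continuous g -> continuous (fun z => Num.max (f z) (g z)).
Proof. exact: max_fun_continuous. Qed.

Lemma continuous_minr f g :
  continuous f -> continuous g -> continuous (fun z => Num.min (f z) (g z)).
Proof. exact: min_fun_continuous. Qed.

End ContinuousOps.

Lemma continuous_pair {Z Y Y' : topologicalType} (f : Z -> Y) (g : Z -> Y') :
  continuous f -> continuous g -> continuous (fun z => (f z, g z)).
Proof. by move=> cf cg z; apply: cvg_pair; [exact: cf|exact: cg]. Qed.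

(** Continuity of the piecewise linear changes of parameters used below. *)
Ltac cont :=
  lazymatch goal with
  | |- forall x, continuous_at x (fun _ => (_, _)) =>
      apply: continuous_pair; cont
  | |- forall x, continuous_at x (fun _ => _ + _) =>
      apply: continuous_add; cont
  | |- forall x, continuous_at x (fun _ => _ * _) =>
      apply: continuous_mul; cont
  | |- forall x, continuous_at x (fun _ => _ *+ _) =>
      apply: continuous_natmul; cont
  | |- forall x, continuous_at x (fun _ => - _) =>
      apply: continuous_opp; cont
  | |- forall x, continuous_at x (fun _ => Num.max _ _) =>
      apply: continuous_maxr; cont
  | |- forall x, continuous_at x (fun _ => Num.min _ _) =>
      apply: continuous_minr; cont
  | |- forall x, continuous_at x -%R => exact: opp_continuous
  | |- forall x, continuous_at x fst => move=> ?; exact: cvg_fst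
  | |- forall x, continuous_at x snd => move=> ?; exact: cvg_snd
  | |- forall x, continuous_at x (fun x => x) => move=> ?; exact: cvg_id
  | |- forall x, continuous_at x (fun x => ?c) => move=> ?; exact: cvg_cst
  | _ => idtac
  end.

(** * The groupoid of paths up to homotopy *)

Section Paths.
Context {R : realType} {X : topologicalType}.
Implicit Types (a b c p : R -> X).

Let zero01 : (0 : R) \in `[0, 1].
Proof. by rewrite in_itv /= lexx ler01. Qed.

Let one01 : (1 : R) \in `[0, 1].
Proof. by rewrite in_itv /= lexx ler01. Qed.

Let rev01 (t : R) : t \in `[0, 1] -> 1 - t \in `[0, 1].
Proof. by rewrite !in_itv /=; lra. Qed.

Let le0half : (0 <= 2^-1 :> R).
Proof. by rewrite invr_ge0 ler0n. Qed.

Let le1half : (1 <= 2^-1 :> R) = false.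
Proof. by apply/negbTE; rewrite -ltNge; lra. Qed.

Let half2 : (2^-1 *+ 2 = 1 :> R).
Proof. by rewrite -[_ *+ 2]mulr_natr mulVf ?pnatr_eq0. Qed.

Let closed_square : closed (`[0 : R, 1] `*` `[0 : R, 1]).
Proof.
have c1 : continuous (@fst R R) by cont.
have c2 : continuous (@snd R R) by cont.
move/continuous_closedP : c1 => /(_ _ (@itv_closed _ _ (0 : R) 1)) c1.
move/continuous_closedP : c2 => /(_ _ (@itv_closed _ _ (0 : R) 1)) c2.
exact: closedI c1 c2.
Qed.

Lemma path_cat0 a b : path_cat a b 0 = a 0.
Proof. by rewrite /path_cat le0half mul0rn. Qed.

Lemma path_cat1 a b : path_cat a b 1 = b 1.
Proof. by rewrite /path_cat le1half mulr2n addrK. Qed.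

Lemma path_invK a : path_inv (path_inv a) = a.
Proof. by apply/funext => t; rewrite /path_inv opprB addrC subrK. Qed.

Lemma path_inv_cat a b : a 1 = b 0 ->
  path_inv (path_cat a b) = path_cat (path_inv b) (path_inv a).
Proof.
move=> ab; apply/funext => t; rewrite /path_inv /path_cat.
have [t2|t2|->] := ltgtP t (2^-1 : R).
- rewrite ifF; first by congr b; ring.
  by apply/negbTE; rewrite -ltNge; lra.
- by rewrite ifT; [congr a; ring|lra].
- rewrite ifT; last by lra.
  have -> : (1 - 2^-1) *+ 2 = 1 :> R by field.
  by rewrite ab; congr b; field.
Qed.

Lemma is_path_inv a : is_path a -> is_path (path_inv a).
Proof.
by move=> pa; apply: (within_comp (u := fun t : R => 1 - t)) pa; [cont|exact: rev01].
Qed.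

Lemma is_path_cat a b : is_path a -> is_path b -> a 1 = b 0 ->
  is_path (path_cat a b).
Proof.
move=> pa pb ab; apply: (@within_glue R R X _ id).
- exact: itv_closed.
- by cont.
- apply: (within_comp (u := fun t : R => t *+ 2)) pa => [|t []].
    by cont.
  by rewrite /= !in_itv /=; lra.
- apply: (within_comp (u := fun t : R => t *+ 2 - 1)) pb => [|t []].
    by cont.
  by rewrite /= !in_itv /=; lra.
- by move=> t _ ->; rewrite half2 subrr.
Qed.

Lemma path_image_cat a b (U : set X) :
  path_image a `<=` U -> path_image b `<=` U ->
  path_image (path_cat a b) `<=` U.
Proof.
move=> aU bU _ [t /= + <-]; rewrite in_itv /path_cat /= => t01.
case: ifPn => t2; [apply: aU|apply: bU].
  by exists (t *+ 2) => //=; rewrite in_itv /=; lra.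
by exists (t *+ 2 - 1) => //=; rewrite in_itv /=; lra.
Qed.

(** The straight-line homotopy between the two changes of parameters [phi] and
    [psi] stays in [0, 1]; composing it with [p] gives the homotopy. *)
Lemma reparam_homotopic p (phi psi : R -> R) a b :
  is_path p -> continuous phi -> continuous psi ->
  (forall t, 0 <= t <= 1 -> 0 <= phi t <= 1) ->
  (forall t, 0 <= t <= 1 -> 0 <= psi t <= 1) ->
  phi 0 = psi 0 -> phi 1 = psi 1 ->
  (forall t, 0 <= t <= 1 -> a t = p (phi t)) ->
  (forall t, 0 <= t <= 1 -> b t = p (psi t)) ->
  path_homotopic a b.
Proof.
move=> pp cphi cpsi phi01 psi01 e0 e1 aE bE.
exists (p \o (fun z : R * R => (1 - z.2) * phi z.1 + z.2 * psi z.1)); split.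
- apply: within_comp pp.
  + apply: continuous_add; apply: continuous_mul; [by cont| |by cont|] => z.
    * by apply: (cvg_comp fst phi); [exact: cvg_fst|exact: cphi].
    * by apply: (cvg_comp fst psi); [exact: cvg_fst|exact: cpsi].
  + move=> [t s] [] /=; rewrite !in_itv /= => t01 s01.
    by have := phi01 _ t01; have := psi01 _ t01; nra.
- move=> t; rewrite in_itv /= => t01; split.
  + by rewrite subr0 mul1r mul0r addr0 aE.
  + by rewrite subrr mul1r mul0r add0r bE.
- move=> s s01; split => /=.
  + by rewrite -e0 aE ?lexx ?ler01//; congr p; ring.
  + by rewrite -e1 aE ?lexx ?ler01//; congr p; ring.
Qed.

Lemma path_homotopic_ends a b : path_homotopic a b -> b 0 = a 0 /\ b 1 = a 1.
Proof.
move=> [H [_ H01 He]]; have [<- <-] := He _ one01.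
by have [_ ->] := H01 _ zero01; have [_ ->] := H01 _ one01.
Qed.

Lemma path_homotopic_refl a : is_path a -> path_homotopic a a.
Proof.
move=> pa.
by apply: (reparam_homotopic (phi := id) (psi := id) pa) => // t; exact: cvg_id.
Qed.

Lemma path_homotopic_sym a b : path_homotopic a b -> path_homotopic b a.
Proof.
move=> ab; have [b0 b1] := path_homotopic_ends ab.
have [H [cH H01 He]] := ab.
exists (H \o (fun z : R * R => (z.1, 1 - z.2))); split => /=.
- apply: within_comp cH => [|[t s] [/= t01 s01]]; first by cont.
  by split => //=; exact: rev01.
- by move=> t t01; rewrite subr0 subrr; have [-> ->] := H01 _ t01.
- by move=> s /rev01 s01; have [-> ->] := He _ s01.
Qed.

Lemma path_homotopic_trans a b c :
  path_homotopic a b -> path_homotopic b c -> path_homotopic a c.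
Proof.
move=> ab [K [cK K01 Ke]]; have [b0 b1] := path_homotopic_ends ab.
have [H [cH H01 He]] := ab.
exists (fun z => if z.2 <= 2^-1 then H (z.1, z.2 *+ 2)
                 else K (z.1, z.2 *+ 2 - 1)); split.
- apply: (within_glue (u := snd)) => //.
  + by cont.
  + apply: (within_comp (u := fun z : R * R => (z.1, z.2 *+ 2))) cH.
      by cont.
    by move=> [t s] []; rewrite /= !in_itv /= => -[t01 s01] s2; split; lra.
  + apply: (within_comp (u := fun z : R * R => (z.1, z.2 *+ 2 - 1))) cK.
      by cont.
    by move=> [t s] []; rewrite /= !in_itv /= => -[t01 s01] s2; split; lra.
  + move=> [t s] [/= t01 _] ->; rewrite half2 subrr.
    by have [_ ->] := H01 _ t01; have [-> _] := K01 _ t01.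
- move=> t t01 /=; rewrite le0half le1half mul0rn mulr2n addrK.
  by have [-> _] := H01 _ t01; have [_ ->] := K01 _ t01.
- move=> s; rewrite in_itv /= => s01; case: ifPn => s2.
    by apply: He; rewrite in_itv /=; lra.
  by rewrite -b0 -b1; apply: Ke; rewrite in_itv /=; lra.
Qed.

Lemma path_homotopic_inv a b :
  path_homotopic a b -> path_homotopic (path_inv a) (path_inv b).
Proof.
move=> [H [cH H01 He]].
exists (H \o (fun z : R * R => (1 - z.1, z.2))); split => /=.
- apply: within_comp cH => [|[t s] [/= t01 s01]]; first by cont.
  by split => //=; exact: rev01.
- by move=> t /rev01 /H01.
- by move=> s /He [e0 e1]; rewrite /path_inv subr0 subrr.
Qed.

Lemma path_homotopic_cat a a' b b' :
  path_homotopic a a' -> path_homotopic b b' -> a 1 = b 0 ->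
  path_homotopic (path_cat a b) (path_cat a' b').
Proof.
move=> [H [cH H01 He]] [K [cK K01 Ke]] ab.
exists (fun z => if z.1 <= 2^-1 then H (z.1 *+ 2, z.2)
                 else K (z.1 *+ 2 - 1, z.2)); split.
- apply: (within_glue (u := fst)) => //.
  + by cont.
  + apply: (within_comp (u := fun z : R * R => (z.1 *+ 2, z.2))) cH.
      by cont.
    by move=> [t s] []; rewrite /= !in_itv /= => -[t01 s01] t2; split; lra.
  + apply: (within_comp (u := fun z : R * R => (z.1 *+ 2 - 1, z.2))) cK.
      by cont.
    by move=> [t s] []; rewrite /= !in_itv /= => -[t01 s01] t2; split; lra.
  + move=> [t s] [/= _ s01] ->; rewrite half2 subrr.
    by have [_ ->] := He _ s01; have [-> _] := Ke _ s01.
- move=> t; rewrite in_itv /= /path_cat => t01; case: ifPn => t2.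
    by apply: H01; rewrite in_itv /=; lra.
  by apply: K01; rewrite in_itv /=; lra.
- move=> s s01; rewrite path_cat0 path_cat1 /= le0half le1half mul0rn mulr2n.
  by rewrite addrK; have [-> _] := He _ s01; have [_ ->] := Ke _ s01.
Qed.

(** Both sides run along [path_cat a b]: the left one goes from the middle
    point back to 0, then up to 1; the right one goes from the middle point
    straight to 1. *)
Lemma path_cat_invK a b : is_path a -> is_path b -> a 1 = b 0 ->
  path_homotopic (path_cat (path_inv a) (path_cat a b)) b.
Proof.
move=> pa pb ab.
apply: (reparam_homotopic (p := path_cat a b)
  (phi := fun t : R => Num.max (2^-1 - t) (t *+ 2 - 1))
  (psi := fun t : R => 2^-1 * (t + 1))).
- exact: is_path_cat.
- by cont.
- by cont.
- by move=> t t01; case: (lerP (2^-1 - t) (t *+ 2 - 1)); lra.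
- by move=> t t01; lra.
- by rewrite subr0 mul0rn; case: (lerP (2^-1 : R)); lra.
- by case: (lerP (2^-1 - 1 : R)); lra.
- move=> t t01; rewrite {1}/path_cat; case: ifPn => t2.
    have -> : Num.max (2^-1 - t) (t *+ 2 - 1) = 2^-1 - t.
      by case: lerP => //; lra.
    rewrite /path_inv /path_cat ifT; last by lra.
    by congr a; field.
  by congr path_cat; case: lerP => //; lra.
- move=> t t01; rewrite /path_cat.
  (* At t = 0 the right side is still on the branch of a. *)
  have [->|t0] := eqVneq t 0.
    by rewrite add0r mulr1 lexx -ab; congr a; field.
  have tp : 0 < t by rewrite lt0r t0; case/andP : t01.
  rewrite ifF; first by congr b; field.
  by apply/negbTE; rewrite -ltNge; lra.
Qed.

(** The left side is the right one precomposed with the piecewise linear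
    homeomorphism of [0, 1] which sends 1/4 to 1/2 and 1/2 to 3/4; being
    concave, it is the minimum of its three linear pieces. *)
Lemma path_catA a b c : is_path a -> is_path b -> is_path c ->
  a 1 = b 0 -> b 1 = c 0 ->
  path_homotopic (path_cat (path_cat a b) c) (path_cat a (path_cat b c)).
Proof.
move=> pa pb pc ab bc.
pose phi (t : R) := Num.min (t *+ 2) (Num.min (t + 4^-1) (2^-1 * (t + 1))).
apply: (reparam_homotopic (p := path_cat a (path_cat b c)) (phi := phi)
  (psi := id)) => //; rewrite /phi.
- by apply: is_path_cat; rewrite ?path_cat0//; apply: is_path_cat.
- by cont.
- by cont.
- by move=> t t01; case: (lerP (t + 4^-1)) => ?; case: (lerP (t *+ 2)); lra.
- by case: (lerP (0 + 4^-1)) => ?; case: (lerP (0 *+ 2)); lra.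
- by case: (lerP (1 + 4^-1)) => ?; case: (lerP (1 *+ 2)); lra.
- move=> t t01; rewrite -/(phi t) [LHS]/path_cat; case: ifPn => t2; last first.
    have -> : phi t = 2^-1 * (t + 1).
      by rewrite /phi; case: (lerP (t + 4^-1)) => ?; case: (lerP (t *+ 2)); lra.
    rewrite /path_cat ifF; last by apply/negbTE; rewrite -ltNge; lra.
    rewrite ifF; last by apply/negbTE; rewrite -ltNge; lra.
    by congr c; field.
  rewrite {1}/path_cat; case: ifPn => t4.
    have -> : phi t = t *+ 2.
      by rewrite /phi; case: (lerP (t + 4^-1)) => ?; case: (lerP (t *+ 2)); lra.
    by rewrite /path_cat t4.
  have -> : phi t = t + 4^-1.
    by rewrite /phi; case: (lerP (t + 4^-1)) => ?; case: (lerP (t *+ 2)); lra.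
  rewrite /path_cat ifF; last by apply/negbTE; rewrite -ltNge; lra.
  rewrite ifT; last by lra.
  by congr b; field.
Qed.

Lemma path_cat_cst a : is_path a -> path_homotopic (path_cat a (fun=> a 1)) a.
Proof.
move=> pa.
apply: (reparam_homotopic (p := a) (phi := fun t : R => Num.min (t *+ 2) 1)
  (psi := id)) => //.
- by cont.
- by cont.
- by move=> t t01; case: (lerP (t *+ 2)); lra.
- by case: (lerP (0 *+ 2)); lra.
- by case: (lerP (1 *+ 2)); lra.
- by move=> t t01; rewrite /path_cat; case: ifPn => t2; congr a; case: lerP; lra.
Qed.

Lemma path_class_eq a b : is_path b ->
  path_class a = path_class b <-> path_homotopic a b.
Proof.
move=> pb; split => [ab|ab].
  by have : path_class b b := path_homotopic_refl pb; rewrite -ab.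
apply/seteqP; split => c /=; last exact: path_homotopic_trans.
exact/path_homotopic_trans/path_homotopic_sym.
Qed.

End Paths.

(** * The whisker and Berestovskii-Plaut topologies *)

Section WhiskerBP.
Context {R : realType} {X : topologicalType} (x0 : X).
Implicit Types (d e : Xtilde R x0) (a b c : R -> X).

Lemma Xtilde_rep d : exists2 a, path_from x0 a & set_val d = path_class a.
Proof. by case: (set_valP d) => a pa ad; exists a => //; exact: esym ad. Qed.

Lemma bp_sym (E : set (X * X)) d e : bp E (d, e) -> bp E (e, d).
Proof.
move=> [a [b [g [[[pa a0] da] [[pb b0] eb] [pg [x gx]] abg]]]].
exists b, a, (path_inv g); split => //.
- split; first exact: is_path_inv.
  exists x => y [t t01 <-]; apply: gx; exists (1 - t) => //.
  by move: t01; rewrite /= !in_itv /=; lra.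
- move/path_homotopic_inv : abg; rewrite path_inv_cat ?path_invK//.
  by rewrite /path_inv subrr a0 b0.
Qed.

Lemma whisker_nbhdP a (U : set X) c d :
  is_path a -> is_path c -> set_val d = path_class c ->
  whisker_nbhd a U d <->
  exists b, [/\ path_from (a 1) b, path_image b `<=` U &
                path_homotopic c (path_cat a b)].
Proof.
move=> pa pc dc; split => -[b [[pb b0] bU H]]; exists b; split => //.
  by apply/path_class_eq; rewrite -?dc//; exact: is_path_cat.
by rewrite dc; apply/path_class_eq => //; exact: is_path_cat.
Qed.

Lemma whisker_nbhd_center a (U : set X) d :
  is_path a -> set_val d = path_class a -> U (a 1) -> whisker_nbhd a U d.
Proof.
move=> pa da Ua; apply/(whisker_nbhdP _ pa pa da); exists (fun=> a 1); split.
- by split => //; apply: continuous_subspaceT; cont.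
- by move=> _ [t _ <-].
- exact/path_homotopic_sym/path_cat_cst.
Qed.

Lemma bp_open_whisker_open (ent : set_system (X * X)) (W : set (Xtilde R x0)) :
  (forall E x, ent E -> exists2 V, open_nbhs x V & V `<=` xsection E x) ->
  uniform_topology (bp_uniformity R x0 ent) W -> whisker_topology R x0 W.
Proof.
move=> entV Wo.
exists [set B | whisker_base B /\ B `<=` W]; first by move=> B [].
apply/seteqP; split => d; first by move=> [B [_ BW] /BW].
move=> Wd; have [D [_ [_ [E entE <-]] ED] DW] := Wo _ Wd.
have [a [pa a0] da] := Xtilde_rep d.
have [V [oV Va] VE] := entV _ (a 1) entE.
exists (whisker_nbhd a V); last exact: whisker_nbhd_center.
split; first by exists a, V.
move=> e [b [[pb b0] bV eb]]; apply: DW; apply/xsectionP; apply: ED.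
exists a, (path_cat a b), b; split => //.
- by split => //; split; [exact: is_path_cat|rewrite path_cat0].
- by split => //; exists (a 1); exact: subset_trans VE.
- exact: path_cat_invK.
Qed.

Lemma whisker_open_bp_open (ent : set_system (X * X)) (W : set (Xtilde R x0)) :
  (forall U y, open_nbhs y U -> exists2 E, ent E &
    forall x, E (x, y) -> xsection E x `<=` U) ->
  whisker_topology R x0 W -> uniform_topology (bp_uniformity R x0 ent) W.
Proof.
move=> entU [F FB <-] d [B FBB Bd].
have [a [U [[pa _] [oU _] BE]]] := FB _ FBB; subst B.
have [c [pc _] dc] := Xtilde_rep d.
have /(whisker_nbhdP _ pa pc dc)[b [[pb b0] bU cab]] := Bd.
have Uc : U (c 1).
  have [_ <-] := path_homotopic_ends cab; rewrite path_cat1.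
  by apply: bU; exists 1 => //=; rewrite in_itv /= lexx ler01.
have [E entE EU] := entU U (c 1) (conj oU Uc).
exists (bp E).
  split; last by exists (bp E) => //; exists E.
  by apply/seteqP; split => -[p q]; exact: bp_sym.
move=> e /xsectionP[c' [c2 [g [[[pc' c'0] /= dc'] [[pc2 c20] /= ec2]]]]].
move=> [pg [x gE]] H.
have cc' : path_homotopic c' c by apply/path_class_eq; rewrite // -dc' -dc.
have c'1 : c' 1 = c 1 by have [_ ->] := path_homotopic_ends cc'.
have g0 : g 0 = c 1.
  by have [-> _] := path_homotopic_ends H; rewrite path_cat0 /path_inv subr0.
have gU : path_image g `<=` U.
  apply: subset_trans (EU x _) => //.
  by rewrite -g0; apply/xsectionP/gE; exists 0; rewrite //= in_itv /= lexx ler01.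
have b1 : b 1 = g 0.
  by have [_] := path_homotopic_ends cab; rewrite path_cat1 g0.
exists (whisker_nbhd a U) => //; apply/(whisker_nbhdP _ pa pc2 ec2).
exists (path_cat b g); split.
- by split; [exact: is_path_cat|rewrite path_cat0].
- exact: path_image_cat.
(* c2 ~ c' * (c'^-1 * c2) ~ (a * b) * g ~ a * (b * g), where the first
   homotopy is path_cat_invK for the path c'^-1. *)
have := path_cat_invK (is_path_inv pc') pc2; rewrite path_invK.
rewrite /path_inv subrr c'0 c20 => /(_ erefl).
move=> /path_homotopic_sym /path_homotopic_trans; apply.
apply: (@path_homotopic_trans _ _ _ (path_cat (path_cat a b) g)).
  apply: path_homotopic_cat => //; first exact: path_homotopic_trans cab.
  by rewrite path_cat0 subr0.
exact: path_catA.
Qed.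

End WhiskerBP.

(** * Entourages of the canonical uniformity *)

(** The hat functions on [0, 1] at the nodes 0, 1/2 and 1, composed with
    [h]. *)
Definition hat_partition (R : realType) (X : Type) (h : X -> R)
    (i : 'I_3) (x : X) : R :=
  [:: Num.max 0 (1 - h x *+ 2); 1 - `|1 - h x *+ 2|;
      Num.max 0 (h x *+ 2 - 1)]`_i.

Lemma continuous_hat_partition (R : realType) (X : topologicalType)
    (h : X -> R) i : continuous h -> continuous (hat_partition h i).
Proof.
move=> ch; have c0 (r : R) : continuous (fun _ : X => r) by cont.
have c2 : continuous (fun x => h x *+ 2) := continuous_natmul ch.
have c1 := continuous_add (c0 1) (continuous_opp c2).
case: i => [[|[|[|//]]] ?]; rewrite /hat_partition /=.
- exact: continuous_maxr.
- exact: continuous_add (c0 1) (continuous_opp (continuous_abs c1)).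
- exact: continuous_maxr (c0 0) (continuous_add c2 (c0 (-1))).
Qed.

Lemma hat_partition_itv (R : realType) (X : Type) (h : X -> R) :
  (forall x, 0 <= h x <= 1) -> forall i x, 0 <= hat_partition h i x <= 1.
Proof.
move=> h01 i x; have := h01 x.
case: i => [[|[|[|//]]] ?]; rewrite /hat_partition /= => ?.
- by case: (lerP 0 (1 - h x *+ 2)); lra.
- by case: (ger0P (1 - h x *+ 2)); lra.
- by case: (lerP 0 (h x *+ 2 - 1)); lra.
Qed.

Lemma hat_partition_of_unity (R : realType) (X : topologicalType) (h : X -> R) :
  continuous h -> (forall x, 0 <= h x <= 1) ->
  partition_of_unity (hat_partition h).
Proof.
move=> ch h01; split.
- by move=> i; exact: continuous_hat_partition.
- exact: hat_partition_itv.
- move=> x; have -> : [set: 'I_3] = [set` index_enum 'I_3].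
    by apply/seteqP; split => i //= _; exact: mem_index_enum.
  rewrite esum_fset; last 2 first.
  - exact: finite_seq.
  - by move=> i _; rewrite lee_fin; have /andP[] := hat_partition_itv h01 i x.
  rewrite -fsbig_seq ?index_enum_uniq// !big_ord_recl big_ord0.
  rewrite /hat_partition /= adde0 -!EFinD; congr (_%:E).
  case: (ger0P (1 - h x *+ 2)); case: (lerP 0 (1 - h x *+ 2));
    by case: (lerP 0 (h x *+ 2 - 1)); lra.
Qed.

(** Only the first hat is nonzero where h = 0, and only the last where h = 1;
    they would force both h x < 1/2 and h x > 1/2. *)
Lemma hat_partition_separates (R : realType) (X : topologicalType)
    (h : X -> R) x y z :
  h y = 0 -> h z = 1 ->
  partition_relation (hat_partition h) (x, y) ->
  partition_relation (hat_partition h) (x, z) -> False.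
Proof.
move=> hy hz [i /= xy] [j /= xz].
have hx0 : h x *+ 2 < 1.
  case: i xy => [[|[|[|//]]] ?]; rewrite /hat_partition /= hy mul0rn.
  - by rewrite subr0 [Num.max 0 1]max_r// mulr1 lt_max ltxx /= subr_gt0.
  - by rewrite subr0 normr1 subrr mulr0 ltxx.
  - by rewrite [Num.max 0 (0 - 1)]max_l ?mulr0 ?ltxx//; lra.
have hx1 : 1 < h x *+ 2.
  case: j xz => [[|[|[|//]]] ?]; rewrite /hat_partition /= hz.
  - by rewrite [Num.max 0 (1 - 2)]max_l ?mulr0 ?ltxx//; lra.
  - have -> : 1 - 2 = - 1 :> R by ring.
    by rewrite normrN normr1 subrr mulr0 ltxx.
  - have -> : 2 - 1 = 1 :> R by ring.
    by rewrite [Num.max 0 1]max_r// mulr1 lt_max ltxx /= subr_gt0.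
by have := lt_trans hx0 hx1; rewrite ltxx.
Qed.

Section Canonical.
Context {R : realType} {X : topologicalType}.

Lemma canonical_entourage_nbhs (E : set (X * X)) x :
  canonical_uniformity R X E -> exists2 V, open_nbhs x V & V `<=` xsection E x.
Proof.
move=> [_ [S [f [[cf f01 f1] fE]]]].
have [s fs] : exists s, 0 < f s x.
  apply: contrapT => nf; have := f1 x.
  rewrite esum1; first by move=> [] /eqP; rewrite eq_sym oner_eq0.
  move=> s _; congr (_%:E); apply/eqP; rewrite eq_le.
  have /andP[-> _] := f01 s x; rewrite andbT leNgt.
  by apply/negP => ?; apply: nf; exists s.
exists [set z | 0 < f s z].
  by split => //; move/continuousP : (cf s) => /(_ _ (@open_gt _ 0)).
by move=> z /= fz; apply/xsectionP/fE; exists s; exact: mulr_gt0.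
Qed.

Lemma partition_relation_sym (S : choiceType) (f : S -> X -> R) :
  symmetric_set (partition_relation f).
Proof. by apply/seteqP; split => -[x y] /= [s]; rewrite mulrC; exists s. Qed.

Lemma canonical_small_entourage (crX : completely_regular_space X)
    (U : set X) y :
  open_nbhs y U -> exists2 E, canonical_uniformity R X E &
    forall x, E (x, y) -> xsection E x `<=` U.
Proof.
move=> [oU Uy].
have /(@uniform_separatorP _ R)[h [ch h01 hy hU]] :
    uniform_separator [set y] (~` U) by apply: crX; first exact: open_closedC.
have {}h01 z : 0 <= h z <= 1.
  by have := h01 (h z); rewrite /= in_itv /=; apply; exists z.
have {}hy : h y = 0 by apply: hy; exists y.
exists (partition_relation (hat_partition h)).
  split; first exact: partition_relation_sym.
  by exists 'I_3, (hat_partition h); split => //; exact: hat_partition_of_unity.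
move=> x xy z /xsectionP xz; apply: contrapT => nUz.
by apply: (hat_partition_separates hy _ xy xz); apply: hU; exists z.
Qed.

End Canonical.

Theorem proposition5p7 (R : realType) (X : topologicalType) (x0 : X)
  (crX : completely_regular_space X) :
  whisker_topology R x0 =
  uniform_topology (bp_uniformity R x0 (canonical_uniformity R X)).
Proof.
apply/seteqP; split => W.
  by apply: whisker_open_bp_open => U y; exact: canonical_small_entourage.
by apply: bp_open_whisker_open => E x; exact: canonical_entourage_nbhs.
Qed.
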